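(* Let $S_M\in\{0,1\}$ be a baseline variable, $M(0),M(1)\in\{0,1\}$ the potential values of a binary mediator under exposure levels $0,1$, $Y(a,m)$ ($a,m\in\{0,1\}$) the controlled potential outcomes, and $Y(a)=Y(a,M(a))$. Suppose necessity, $P(M(b)=1\mid S_M=0,X)=0$ for each $b\in\{0,1\}$, and sufficiency-under-treatment, $P(M(1)=1\mid S_M=1,X)=1$. Then for each $a\in\{0,1\}$, $$\mathbb{E}[Y(a,M(1))]=\mathbb{E}[Y(a,1)\mid S_M=1]\,P(S_M=1)+\mathbb{E}[Y(a,0)\mid S_M=0]\,P(S_M=0).$$ Moreover, setting $$\Delta^{\text{dir-t}}_1=\mathbb{E}[Y(1,1)-Y(0,1)\mid S_M=1],\quad \Delta^{\text{dir-t}}_0=\mathbb{E}[Y(1,0)-Y(0,0)\mid S_M=0],\quad \Delta^{\text{indir-t}}_1=\mathbb{E}[Y(0,1)-Y(0)\mid S_M=1],$$ the total natural direct effect, pure natural indirect effect and total effect satisfy $$\mathbb{E}[Y(1,M(1))-Y(0,M(1))]=\Delta^{\text{dir-t}}_1P(S_M=1)+\Delta^{\text{dir-t}}_0P(S_M=0),$$ $$\mathbb{E}[Y(0,M(1))-Y(0)]=\Delta^{\text{indir-t}}_1P(S_M=1),$$ $$\mathbb{E}[Y(1)-Y(0)]=(\Delta^{\text{dir-t}}_1+\Delta^{\text{indir-t}}_1)P(S_M=1)+\Delta^{\text{dir-t}}_0P(S_M=0),$$ with $\Delta^{\text{dir-t}}_1+\Delta^{\text{indir-t}}_1=\mathbb{E}[Y(1)-Y(0)\mid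 S_M=1]$ and $\Delta^{\text{dir-t}}_0=\mathbb{E}[Y(1)-Y(0)\mid S_M=0]$.
   Context: All variables, including baseline covariates $X$, are defined on one probability space. $Y(a,M(a'))$ denotes $Y(a,m)$ evaluated at the random value $m=M(a')$. Conditional statements given $S_M=s$ and $X$ hold almost surely wherever the conditioning event has positive conditional probability. All displayed expectations are assumed finite, and the identities involving conditioning on $S_M=s$ are for $P(S_M=s)>0$, a product with $P(S_M=s)=0$ being read as $0$. *)

(* Defs.v *)
From HB Require Import structures.
From mathcomp Require Import all_boot all_order all_algebra.
From mathcomp Require Import all_classical all_reals all_analysis.

Set Implicit Arguments.
Unset Strict Implicit.
Unset Printing Implicit Defensive.

Import Order.TTheory GRing.Theory Num.Theory.
Import numFieldNormedType.Exports.

Local Open Scope classical_set_scope.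
Local Open Scope ring_scope.
Local Open Scope ereal_scope.

Definition event_eq (T : Type) (S : T -> bool) (s : bool) : set T :=
  S @^-1` [set s].

(* Y(a, M(a')); in particular Y(a) = Y(a, M(a)) is [nested Y M a a]. *)
Definition nested (R : Type) (T : Type) (Y : bool -> bool -> T -> R)
    (M : bool -> T -> bool) (a a' : bool) : T -> R :=
  fun w => Y a (M a' w) w.

(* E[Z | A] for an event A; equal to 0 when P A = 0. *)
Definition cond_expectation d (T : measurableType d) (R : realType)
    (P : probability T R) (Z : T -> R) (A : set T) : \bar R :=
  (\int[P]_(w in A) (Z w)%:E) * ((fine (P A))^-1)%:E.

(* g is a version of x |-> P(A | X = x), that is, g \o X is a version of
   P(A | X). *)
Definition is_cond_prob d dX (T : measurableType d) (TX : measurableType dX)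
    (R : realType) (P : probability T R) (X : {RV P >-> TX}) (A : set T)
    (g : TX -> R) : Prop :=
  (distribution P X).-integrable setT (EFin \o g) /\
  forall B, measurable B ->
    P (A `&` X @^-1` B) = \int[distribution P X]_(x in B) (g x)%:E.

Lemma is_cond_prob_exists d dX (T : measurableType d) (TX : measurableType dX)
    (R : realType) (P : probability T R) (X : {RV P >-> TX}) (A : set T) :
  measurable A -> exists g : TX -> R, is_cond_prob X A g.
Proof.
move=> mA.
have PA : P A < +oo by rewrite ltey_eq fin_num_measure.
pose PrA : {finite_measure set T -> \bar R} := mfrestr mA PA.
have mX : measurable_fun setT X by [].
have mXB B : measurable B -> measurable (X @^-1` B).
  by move=> mB; rewrite -[_ @^-1` _]setTI; exact: mX.
pose nu0 : {measure set TX -> \bar R} := pushforward PrA X.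
have nu0fin : fin_num_fun (nu0 mX).
  by move=> B mB; apply: (@fin_num_measure _ _ _ PrA); exact: mXB.
pose nu0finM := Measure_isFinite.Build _ _ _ (nu0 mX) nu0fin.
pose nu : {finite_measure set TX -> \bar R} :=
  HB.pack (Measure.sort (nu0 mX)) nu0finM.
have nuE B : nu B = P (A `&` X @^-1` B).
  by rewrite /nu /= /pushforward /PrA /= /mfrestr /mrestr setIC.
have nudom : nu `<< distribution P X.
  apply/null_content_dominatesP => B mB PB0; rewrite nuE.
  apply/eqP; rewrite eq_le measure_ge0 andbT -PB0.
  have mXB' := mXB _ mB.
  by apply: le_measure; rewrite ?inE//; exact: measurableI.
pose f := Radon_Nikodym_SigmaFinite.f nu (distribution P X).
have ffin x : f x \is a fin_num by exact: Radon_Nikodym_SigmaFinite.f_fin_num.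
have fE : EFin \o (fine \o f) = f by apply/funext => x /=; rewrite fineK.
exists (fine \o f); split.
  by rewrite fE; exact: Radon_Nikodym_SigmaFinite.f_integrable.
move=> B mB; rewrite -nuE (Radon_Nikodym_SigmaFinite.f_integral nudom)//.
by apply: eq_integral => x _; rewrite /= fineK.
Qed.

(* P(A | S = s, X) = c almost surely where P(S = s | X) > 0, with
   P(A | S = s, X) the ratio P(A, S = s | X) / P(S = s | X).  Versions exist
   for all events involved (lemma [is_cond_prob_exists]) and are almost surely
   unique, so the choice of p and q is immaterial. *)
Definition cond_prob_given_eq d dX (T : measurableType d)
    (TX : measurableType dX) (R : realType) (P : probability T R)
    (X : {RV P >-> TX}) (S : {RV P >-> bool}) (s : bool) (A : set T) (c : R) :
    Prop :=
  forall p q : TX -> R,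
    is_cond_prob X (A `&` event_eq S s) p ->
    is_cond_prob X (event_eq S s) q ->
    {ae distribution P X, forall x, (0 < q x)%R -> (p x / q x = c)%R}.

(* Main.v *)
(* Integrating the two conditional hypotheses over the law of X shows that,
   up to null events, M(0) = M(1) = 0 on {S_M = 0} and M(1) = 1 on
   {S_M = 1}.  Hence Y(a, M(1)) agrees almost surely with Y(a, s) on
   {S_M = s}, and the formulas are the law of total expectation for
   Y(a, M(1)), Y(1) - Y(0) and the other two contrasts, together with
   linearity of conditional expectation. *)
Require Import Defs.
From mathcomp Require Import all_boot all_order all_algebra.
From mathcomp Require Import all_classical all_reals all_analysis.
From mathcomp Require Import measurable_realfun.
Set Implicit Arguments.
Unset Strict Implicit.
Unset Printing Implicit Defensive.
Import Order.TTheory GRing.Theory Num.Theory.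
Import numFieldNormedType.Exports.
Local Open Scope classical_set_scope.
Local Open Scope ring_scope.
Local Open Scope ereal_scope.

Lemma measurable_event_eq d (T : measurableType d) (R : realType)
    (P : probability T R) (S : {RV P >-> bool}) (s : bool) :
  measurable (event_eq S s).
Proof. by rewrite /event_eq -[X in measurable X]setTI; exact: measurable_funPT. Qed.

Lemma setC_event_eq (T : Type) (S : T -> bool) (s : bool) :
  ~` event_eq S s = event_eq S (~~ s).
Proof.
by apply/seteqP; split => w; rewrite /event_eq /=; case: (S w) s => -[].
Qed.

(* The event {q o X <= 0} has mass \int_(q <= 0) q <= 0 in {S = s}, so it does
   not contribute to either side; elsewhere p = c q almost surely. *)
Lemma cond_prob_given_eqP d dX (T : measurableType d)
    (TX : measurableType dX) (R : realType) (P : probability T R)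
    (X : {RV P >-> TX}) (S : {RV P >-> bool}) (s : bool) (A : set T) (c : R) :
  measurable A -> cond_prob_given_eq X S s A c ->
  P (A `&` event_eq S s) = c%:E * P (event_eq S s).
Proof.
move=> mA h.
have mS := measurable_event_eq S s.
have mAS : measurable (A `&` event_eq S s) by exact: measurableI.
have [p [ip hp]] := is_cond_prob_exists X mAS.
have [q [iq hq]] := is_cond_prob_exists X mS.
have hpq := h p q (conj ip hp) (conj iq hq).
have mq : measurable_fun setT (fun x => (q x)%:E).
  exact: measurable_int iq.
(* [B] is the region where the hypothesis speaks: the ratio [p x / q x] is only controlled where
   [q x] is positive. *)
pose B : set TX := [set x | 0 < (q x)%:E].
have mB : measurable B.
  by rewrite /B -[X in measurable X]setTI; exact: emeasurable_fun_o_infty.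
have mX C : measurable C -> measurable (X @^-1` C).
  by move=> mC; rewrite -[X in measurable X]setTI; exact: measurable_funPT.
have SB0 : P (event_eq S s `&` X @^-1` (~` B)) = 0.
  apply/eqP; rewrite eq_le measure_ge0 andbT hq; last exact: measurableC.
  rewrite -(integral0 (distribution P X) (~` B)).
  have mBC := measurableC mB.
  apply: le_integral => //; [exact: integrableS iq|exact: integrable0|].
  by move=> x; rewrite inE => /negP; rewrite -leNgt.
have ASB0 : P (A `&` event_eq S s `&` X @^-1` (~` B)) = 0.
  apply/eqP; rewrite eq_le measure_ge0 andbT -SB0.
  apply: le_measure; rewrite ?inE//.
  - by apply: measurableI => //; exact/mX/measurableC.
  - by apply: measurableI => //; exact/mX/measurableC.
  - by rewrite -setIA; exact: subIsetr.
(* An event with no mass over the complement of [B] can be cut down to [B], where its mass is an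
   integral of [p] or [q] against the law of [X]. *)
have split_B (E : set T) : measurable E -> P (E `&` X @^-1` (~` B)) = 0 ->
    P E = P (E `&` X @^-1` B).
  move=> mE E0; have -> : P E = P (E `\` X @^-1` B) + P (E `&` X @^-1` B).
    by apply: measureDI => //; exact: mX.
  by rewrite setDE preimage_setC E0 add0e.
rewrite (split_B _ mAS ASB0) (split_B _ mS SB0) hp// hq//.
rewrite -integralZl//; last exact: integrableS iq.
apply: ae_eq_integral => //.
- by apply: measurable_funTS; exact: measurable_int ip.
- by apply: measurable_funTS; exact: measurable_funeM.
- apply: filterS hpq => x hx Bx; have q0 : (0 < q x)%R by rewrite -lte_fin.
  by rewrite -EFinM -(hx q0) divfK// gt_eqF.
Qed.

(** The exceptional set is the intersection of [A] with the stratum, whose mass is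
    [0 * P (event_eq S s)]. The covariates are gone from here on. *)
Lemma cond_prob_given_eq0 d dX (T : measurableType d)
    (TX : measurableType dX) (R : realType) (P : probability T R)
    (X : {RV P >-> TX}) (S : {RV P >-> bool}) (s : bool) (A : set T) :
  measurable A -> cond_prob_given_eq X S s A 0%R ->
  {ae P, forall w, event_eq S s w -> ~ A w}.
Proof.
move=> mA /(cond_prob_given_eqP mA); rewrite mul0e => h.
exists (A `&` event_eq S s); split => //.
  by apply: measurableI => //; exact: measurable_event_eq.
by move=> w /= /not_implyP[Sw /contrapT].
Qed.

(** [A] carries the full mass of the stratum, which is finite, so subtraction leaves mass 0 for the
    part of the stratum outside [A]. *)
Lemma cond_prob_given_eq1 d dX (T : measurableType d)
    (TX : measurableType dX) (R : realType) (P : probability T R)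
    (X : {RV P >-> TX}) (S : {RV P >-> bool}) (s : bool) (A : set T) :
  measurable A -> cond_prob_given_eq X S s A 1%R ->
  {ae P, forall w, event_eq S s w -> A w}.
Proof.
move=> mA /(cond_prob_given_eqP mA); rewrite mul1e => h.
have mS := measurable_event_eq S s.
exists (event_eq S s `\` A); split.
- exact: measurableD.
- have -> : P (event_eq S s `\` A) = P (event_eq S s) - P (event_eq S s `&` A).
    by apply: measureD => //; rewrite ltey_eq fin_num_measure.
  by rewrite setIC h subee// fin_num_measure.
- by move=> w /= /not_implyP[].
Qed.

Section conditional_expectation.
Context d (T : measurableType d) (R : realType) (P : probability T R).
Implicit Types (Z W : T -> R) (A : set T).

Lemma cond_expectationM Z A : measurable A -> measurable_fun setT Z ->
  cond_expectation P Z A * P A = \int[P]_(w in A) (Z w)%:E.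
Proof.
move=> mA mZ; have PAfin : P A \is a fin_num by exact: fin_num_measure.
(* On a null event the product vanishes by the convention [x * 0 = 0], and so does the integral;
   otherwise the normalising factor cancels. *)
have [PA0|PA0] := eqVneq (P A) 0.
  by rewrite PA0 mule0 null_set_integral//; exact/measurable_EFinP/measurable_funTS.
rewrite /cond_expectation -{2}(fineK PAfin) -muleA -EFinM mulVf ?mule1//.
by rewrite fine_eq0.
Qed.

(** Only measurability is asked, because it is applied to the variables [Y a s], which are not
    assumed integrable. *)
Lemma cond_expectation_ae_eq Z W A : measurable A ->
  measurable_fun setT Z -> measurable_fun setT W ->
  {ae P, forall w, A w -> Z w = W w} ->
  cond_expectation P Z A = cond_expectation P W A.
Proof.
move=> mA mZ mW ZW; rewrite /cond_expectation; congr (_ * _).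
apply: ae_eq_integral => //.
- exact/measurable_EFinP/measurable_funTS.
- exact/measurable_EFinP/measurable_funTS.
- by apply: filterS ZW => w h Aw; rewrite h.
Qed.

Lemma cond_expectationD Z W A : measurable A ->
  P.-integrable setT (EFin \o Z) -> P.-integrable setT (EFin \o W) ->
  cond_expectation P (Z \+ W)%R A =
  cond_expectation P Z A + cond_expectation P W A.
Proof.
move=> mA iZ iW; rewrite /cond_expectation -muleDl//.
- congr (_ * _).
  by rewrite -integralD//; [exact: integrableS iZ|exact: integrableS iW].
(* Distributivity in the extended reals needs the sum to be defined; a finite first integral rules
   out opposite infinities. *)
- by apply: fin_num_adde_defr; apply: integrable_fin_num => //; exact: integrableS iZ.
Qed.

Lemma total_expectation Z (S : {RV P >-> bool}) :
  P.-integrable setT (EFin \o Z) ->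
  'E_P[Z] = cond_expectation P Z (event_eq S true) * P (event_eq S true) +
            cond_expectation P Z (event_eq S false) * P (event_eq S false).
Proof.
move=> iZ; have mZ : measurable_fun setT Z.
  exact/measurable_EFinP/(measurable_int P).
have mS s := measurable_event_eq S s.
rewrite !cond_expectationM// unlock.
have disjS : [disjoint event_eq S true & event_eq S false].
  by apply/disj_setPS => w [/=]; rewrite /event_eq /= => ->.
have -> : [set: T] = event_eq S true `|` event_eq S false.
  by rewrite -(setC_event_eq S true) setUv.
by rewrite integral_setU//; exact/measurable_EFinP/measurable_funTS.
Qed.

End conditional_expectation.

(** A binary mediator merely selects between two measurable outcomes, so substituting its random
    value is a measurable case distinction. *)
Lemma measurable_nested d (T : measurableType d) (R : realType)
    (P : probability T R) (Y : bool -> bool -> {RV P >-> R})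
    (M : bool -> {RV P >-> bool}) (a b : bool) :
  measurable_fun setT (nested Y M a b).
Proof.
rewrite (_ : nested Y M a b =
  fun w => if M b w then Y a true w else Y a false w); last first.
  by apply/funext => w; rewrite /nested; case: (M b w).
exact: measurable_fun_ifT.
Qed.

Theorem mainTheorem4 (d dX : measure_display) (T : measurableType d)
    (TX : measurableType dX) (R : realType) (P : probability T R)
    (X : {RV P >-> TX}) (SM : {RV P >-> bool}) (M : bool -> {RV P >-> bool})
    (Y : bool -> bool -> {RV P >-> R})
    (necessity : forall b : bool,
      cond_prob_given_eq X SM false (event_eq (M b) true) 0%R)
    (sufficiency : cond_prob_given_eq X SM true (event_eq (M true) true) 1%R)
    (* finiteness of the remaining expectations follows from these two *)
    (YM1_integrable : forall a : bool,
      P.-integrable setT (EFin \o nested Y M a true))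
    (indirect_integrable :
      P.-integrable setT
        (EFin \o (nested Y M false true \- nested Y M false false)%R)) :
  let pS (s : bool) : \bar R := P (event_eq SM s) in
  let E_given (Z : T -> R) (s : bool) : \bar R :=
    cond_expectation P Z (event_eq SM s) in
  let Ytot (a : bool) : T -> R := nested Y M a a in
  let dir1 := E_given (Y true true \- Y false true)%R true in
  let dir0 := E_given (Y true false \- Y false false)%R false in
  let indir1 := E_given (Y false true \- Ytot false)%R true in
  (forall a : bool,
     'E_P[nested Y M a true] =
       E_given (Y a true) true * pS true + E_given (Y a false) false * pS false)
  /\ 'E_P[(nested Y M true true \- nested Y M false true)%R] =
       dir1 * pS true + dir0 * pS false
  /\ 'E_P[(nested Y M false true \- Ytot false)%R] = indir1 * pS true
  /\ 'E_P[(Ytot true \- Ytot false)%R] =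
       (dir1 + indir1) * pS true + dir0 * pS false
  /\ (0 < pS true ->
        dir1 + indir1 = E_given (Ytot true \- Ytot false)%R true)
  /\ (0 < pS false ->
        dir0 = E_given (Ytot true \- Ytot false)%R false).
Proof.
move=> pS E_given Ytot dir1 dir0 indir1.
have mS s : measurable (event_eq SM s) by exact: measurable_event_eq.
have mM b : measurable (event_eq (M b) true) by exact: measurable_event_eq.
have mN a b : measurable_fun setT (nested Y M a b) by exact: measurable_nested.
have mYtot a : measurable_fun setT (Ytot a) by exact: mN.
have M0 b : {ae P, forall w, event_eq SM false w -> M b w = false}.
  have := cond_prob_given_eq0 (mM b) (necessity b).
  by apply: filterS => w h /h /negP/negbTE.
have M1 : {ae P, forall w, event_eq SM true w -> M true w = true}.
  exact: cond_prob_given_eq1 (mM true) sufficiency.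
have MS s : {ae P, forall w, event_eq SM s w -> M true w = s}.
  by case: s; [exact: M1|exact: M0].
have YS a s : E_given (Y a s) s = E_given (nested Y M a true) s.
  apply: cond_expectation_ae_eq => //.
  by apply: filterS (MS s) => w h /h; rewrite /nested => ->.
have dirS s : E_given (Y true s \- Y false s)%R s =
    E_given (nested Y M true true \- nested Y M false true)%R s.
  apply: cond_expectation_ae_eq; [exact: mS|exact: measurable_funB|exact: measurable_funB|].
  by apply: filterS (MS s) => w h /h; rewrite /nested /= => ->.
have indir1E : indir1 = E_given (nested Y M false true \- Ytot false)%R true.
  apply: cond_expectation_ae_eq; [exact: mS|exact: measurable_funB|exact: measurable_funB|].
  by apply: filterS M1 => w h /h; rewrite /Ytot /nested /= => ->.
(* Necessity is used at both exposure levels here: for [S_M = 0] both terms of the contrast are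
   almost surely [Y false false]. *)
have indir0E : E_given (nested Y M false true \- Ytot false)%R false = 0.
  rewrite [LHS](@cond_expectation_ae_eq _ _ _ _ _ (cst 0%R))//.
  - by rewrite /cond_expectation integral0 mul0e.
  - exact: measurable_funB.
  - apply: filterS2 (M0 true) (M0 false) => w h1 h0 Sw.
    by rewrite /Ytot /nested /= h1// h0// subrr.
have idir : P.-integrable setT
    (EFin \o (nested Y M true true \- nested Y M false true)%R).
  rewrite (_ : EFin \o _ = (EFin \o nested Y M true true) \-
    (EFin \o nested Y M false true)); first exact: integrableB.
  by apply/funext => w; rewrite /= EFinB.
(* Telescoping through [Y(0, M(1))] makes the total contrast the sum of the direct and indirect
   ones. It thus inherits integrability from them and splits stratum by stratum. *)
have totE : (Ytot true \- Ytot false = (nested Y M true true \-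
    nested Y M false true) \+ (nested Y M false true \- Ytot false))%R.
  by apply/funext => w; rewrite /= subrKA.
have itot : P.-integrable setT (EFin \o (Ytot true \- Ytot false)%R).
  rewrite totE (_ : EFin \o _ =
    (EFin \o (nested Y M true true \- nested Y M false true)%R) \+
    (EFin \o (nested Y M false true \- Ytot false)%R)); first exact: integrableD.
  by apply/funext => w; rewrite /= EFinD.
have splitE s : E_given (Ytot true \- Ytot false)%R s =
    E_given (nested Y M true true \- nested Y M false true)%R s +
    E_given (nested Y M false true \- Ytot false)%R s.
  by rewrite totE; exact: cond_expectationD.
(* These two identities serve twice: as the last two claims, and to reduce the total effect formula
   to the law of total expectation. *)
have tot1 : dir1 + indir1 = E_given (Ytot true \- Ytot false)%R true.
  by rewrite splitE indir1E /dir1 dirS.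
have tot0 : dir0 = E_given (Ytot true \- Ytot false)%R false.
  by rewrite splitE indir0E adde0 /dir0 dirS.
have totalE Z : P.-integrable setT (EFin \o Z) ->
    'E_P[Z] = E_given Z true * pS true + E_given Z false * pS false.
  exact: total_expectation.
split; first by move=> a; rewrite !YS; exact: totalE.
split; first by rewrite /dir1 /dir0 !dirS; exact: totalE.
split; first by rewrite totalE// indir0E mul0e adde0 indir1E.
by split; first by rewrite tot1 tot0; exact: totalE.
Qed.
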